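(* Let $\varrho$ be an entangled state (density matrix) of two qubits on $\mathbb{C}^2\otimes\mathbb{C}^2$, shared between Alice (first qubit) and Bob (second qubit). Suppose that each of the two parties can steer the other party's qubit into two different pure states by performing some orthogonal projective measurement $\{\mathcal{P}_{\vec n}^0,\mathcal{P}_{\vec n}^1\}$ on her/his own qubit (the measurement may be different for Alice and for Bob). Then $\varrho$ violates local realism.
   Context: A two-qubit state is a positive semidefinite trace-one operator $\varrho$ on $\mathbb{C}^2\otimes\mathbb{C}^2$ (not necessarily of rank one). It is entangled if it is not a convex combination of product states $\rho^A\otimes\rho^B$. Orthogonal projective measurement on a qubit: for a unit vector $\vec n\in\mathbb{R}^3$, $\mathcal{P}_{\vec n}^0=|{+\vec n}\rangle\langle{+\vec n}|$ and $\mathcal{P}_{\vec n}^1=|{-\vec n}\rangle\langle{-\vec n}|$, where $\{|{+\vec n}\rangle,|{-\vec n}\rangle\}$ is the orthonormal eigenbasis of $\vec n\cdot\vec\sigma$ in $\mathbb{C}^2$ ($\vec\sigma$ the vector of Pauli matrices); equivalently, an arbitrary pair of rank-one projectors onto an orthonormal basis of $\mathbb{C}^2$. Steering into two different pure states: Alice can steer Bob's qubit into two different pure states by the measurement $\{\mathcal{P}_{\vec n}^0,\mathcal{P}_{\vec n}^1\}$ if, for each $a\in\{0,1\}$, the outcome probability $p_a=\mathrm{tr}[(\mathcal{P}_{\vec n}^a\otimes I)\varrho]$ is nonzero and the normalized conditional state of Bob's qubit, $p_a^{-1}\,\mathrm{tr}_A[(\mathcal{P}_{\vec n}^a\otimes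 I)\varrho]$, is a pure state (a rank-one projector), and the two pure states obtained for $a=0$ and $a=1$ are different. Steering of Alice's qubit by Bob is defined in the same way with the roles exchanged. Violation of local realism: $\varrho$ violates local realism if there are finitely many projective measurements for each party, indexed by settings $i$ (Alice) and $j$ (Bob), such that the quantum probabilities $p(a,b|i,j)=\mathrm{tr}[(\mathcal{P}^{a}_{A_i}\otimes\mathcal{P}^{b}_{B_j})\varrho]$ admit no local hidden variable model, i.e. cannot be written as $p(a,b|i,j)=\int d\mu(\lambda)\,p_A(a|i,\lambda)\,p_B(b|j,\lambda)$ with $\mu$ a probability measure and $p_A(\cdot|i,\lambda)$, $p_B(\cdot|j,\lambda)$ probability distributions. Equivalently, some Bell inequality (an inequality satisfied by all local hidden variable models) is violated by $\varrho$ for some choice of local projective measurements. *)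

(* Defs.v *)
From HB Require Import structures.
From mathcomp Require Import all_boot all_order all_algebra.
From mathcomp Require Import sesquilinear spectral.
From mathcomp Require Import complex mxtens.
From mathcomp Require Import all_classical all_reals all_analysis.

Set Implicit Arguments.
Unset Strict Implicit.
Unset Printing Implicit Defensive.

Import Order.TTheory GRing.Theory Num.Theory.

Local Open Scope ring_scope.
Local Open Scope complex_scope.
Local Open Scope sesquilinear_scope.

Definition psdmx (R : realType) (n : nat) (A : 'M[R[i]]_n) : Prop :=
  A \is hermsymmx /\ forall v : 'cV[R[i]]_n, 0 <= (v ^t* *m A *m v) 0 0.

Definition is_state (R : realType) (n : nat) (rho : 'M[R[i]]_n) : Prop :=
  psdmx rho /\ \tr rho = 1.

(* A rank-one orthogonal projector. *)
Definition is_pure (R : realType) (n : nat) (rho : 'M[R[i]]_n) : Prop :=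
  [/\ rho \is hermsymmx, rho *m rho = rho & \rank rho = 1%N].

Definition is_separable (R : realType) (rho : 'M[R[i]]_(2 * 2)) : Prop :=
  exists (k : nat) (w : 'I_k -> R) (rhoA rhoB : 'I_k -> 'M[R[i]]_2),
    [/\ forall i, 0 <= w i,
        \sum_i w i = 1,
        forall i, is_state (rhoA i) /\ is_state (rhoB i)
      & rho = \sum_i (w i)%:C *: (rhoA i *t rhoB i)].

Definition is_entangled (R : realType) (rho : 'M[R[i]]_(2 * 2)) : Prop :=
  is_state rho /\ ~ is_separable rho.

Definition pauli_x (R : realType) : 'M[R[i]]_2 :=
  delta_mx 0 1 + delta_mx 1 0.
Definition pauli_y (R : realType) : 'M[R[i]]_2 :=
  - 'i%C *: delta_mx 0 1 + 'i%C *: delta_mx 1 0.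
Definition pauli_z (R : realType) : 'M[R[i]]_2 :=
  delta_mx 0 0 - delta_mx 1 1.

Definition pauli_dot (R : realType) (n : 'rV[R]_3) : 'M[R[i]]_2 :=
  (n 0 0)%:C *: pauli_x R + (n 0 1)%:C *: pauli_y R
  + (n 0 ord_max)%:C *: pauli_z R.

(* e 0 and e 1 are the eigenvectors |+n> and |-n>, with eigenvalues 1, -1. *)
Definition is_proj_meas (R : realType) (n : 'rV[R]_3)
    (P : 'I_2 -> 'M[R[i]]_2) : Prop :=
  \sum_k n 0 k ^+ 2 = 1 /\
  exists e : 'I_2 -> 'cV[R[i]]_2,
    [/\ forall a b, e a ^t* *m e b = ((a == b)%:R)%:M,
        forall a, pauli_dot n *m e a = (-1) ^+ a *: e a
      & forall a, P a = e a *m e a ^t*].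

(* The tensor product *t pairs indices by mxtens_index, the left factor being
   Alice's; ptraceA and ptraceB trace out Alice's and Bob's qubit. *)
Definition ptraceA (R : realType) (X : 'M[R[i]]_(2 * 2)) : 'M[R[i]]_2 :=
  \matrix_(j, k) \sum_i X (mxtens_index (i, j)) (mxtens_index (i, k)).

Definition ptraceB (R : realType) (X : 'M[R[i]]_(2 * 2)) : 'M[R[i]]_2 :=
  \matrix_(j, k) \sum_i X (mxtens_index (j, i)) (mxtens_index (k, i)).

Definition probA (R : realType) (rho : 'M[R[i]]_(2 * 2)) (E : 'M[R[i]]_2) :
    R[i] := \tr ((E *t 1%:M) *m rho).

Definition probB (R : realType) (rho : 'M[R[i]]_(2 * 2)) (E : 'M[R[i]]_2) :
    R[i] := \tr ((1%:M *t E) *m rho).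

Definition steered_toB (R : realType) (rho : 'M[R[i]]_(2 * 2))
    (E : 'M[R[i]]_2) : 'M[R[i]]_2 :=
  (probA rho E)^-1 *: ptraceA ((E *t 1%:M) *m rho).

Definition steered_toA (R : realType) (rho : 'M[R[i]]_(2 * 2))
    (E : 'M[R[i]]_2) : 'M[R[i]]_2 :=
  (probB rho E)^-1 *: ptraceB ((1%:M *t E) *m rho).

Definition alice_steers_pure (R : realType) (rho : 'M[R[i]]_(2 * 2)) : Prop :=
  exists (n : 'rV[R]_3) (P : 'I_2 -> 'M[R[i]]_2),
    [/\ is_proj_meas n P,
        forall a, probA rho (P a) <> 0 /\ is_pure (steered_toB rho (P a))
      & steered_toB rho (P 0) <> steered_toB rho (P 1)].

Definition bob_steers_pure (R : realType) (rho : 'M[R[i]]_(2 * 2)) : Prop :=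
  exists (n : 'rV[R]_3) (P : 'I_2 -> 'M[R[i]]_2),
    [/\ is_proj_meas n P,
        forall b, probB rho (P b) <> 0 /\ is_pure (steered_toA rho (P b))
      & steered_toA rho (P 0) <> steered_toA rho (P 1)].

(* p i j a b is the value of p(a,b|i,j); it is complex-valued so that it can be
   a trace, and the model forces it to equal a real integral. *)
Definition has_lhv_model (R : realType) (mA mB : nat)
    (p : 'I_mA -> 'I_mB -> 'I_2 -> 'I_2 -> R[i]) : Prop :=
  exists (d : measure_display) (T : measurableType d) (mu : probability T R)
      (pA : 'I_mA -> 'I_2 -> T -> R) (pB : 'I_mB -> 'I_2 -> T -> R),
    [/\ (forall i a, measurable_fun [set: T] (pA i a)) /\
        (forall j b, measurable_fun [set: T] (pB j b)),
        forall i l, (forall a, 0 <= pA i a l) /\ \sum_a pA i a l = 1,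
        forall j l, (forall b, 0 <= pB j b l) /\ \sum_b pB j b l = 1
      & forall i j a b,
          p i j a b = (Rintegral mu [set: T] (fun l => pA i a l * pB j b l))%:C].

Definition violates_local_realism (R : realType) (rho : 'M[R[i]]_(2 * 2)) :
    Prop :=
  exists (mA mB : nat) (nA : 'I_mA -> 'rV[R]_3) (nB : 'I_mB -> 'rV[R]_3)
      (PA : 'I_mA -> 'I_2 -> 'M[R[i]]_2) (PB : 'I_mB -> 'I_2 -> 'M[R[i]]_2),
    [/\ forall i, is_proj_meas (nA i) (PA i),
        forall j, is_proj_meas (nB j) (PB j)
      & ~ has_lhv_model (fun i j a b => \tr ((PA i a *t PB j b) *m rho))].

(* Main.v *)
(* A pure conditional state of Bob has a kernel vector, so by positivity rho
   kills e_a (x) g_a for Alice's measurement basis e and suitable vectors g_a;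
   hence rho = sum_ab c_ab u_a u_b^* with u_a = e_a (x) phi_a and phi_a
   orthogonal to g_a, and c_01 <> 0 since otherwise rho is separable.
   - If det c = 0, rho is pure and its Schmidt bases e', f' satisfy
     rho (e'_a (x) f'_a) = 0 after relabelling.
   - If det c <> 0, the kernel of rho is exactly the orthogonal complement of
     {u_0, u_1}; the product vectors h_b (x) f_b it contains by Bob's steering
     force phi_0, phi_1 to be proportional to the two elements of Bob's basis.
   In both cases rho = p0 |00><00| + p1 |11><11| + r (|00><11| + |11><00|) in
   local orthonormal bases with r > 0. Such a state has <ZZ> = 1 and
   <XX> = 2r, so it violates the CHSH inequality. *)
Require Import Defs.
From mathcomp Require Import all_boot all_order all_algebra.
From mathcomp Require Import sesquilinear spectral.
From mathcomp Require Import complex mxtens ring lra.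
From mathcomp Require Import all_classical all_reals all_analysis.
From mathcomp Require Import measurable_realfun.

Set Implicit Arguments.
Unset Strict Implicit.
Unset Printing Implicit Defensive.

Import Order.TTheory GRing.Theory Num.Theory.

Local Open Scope ring_scope.
Local Open Scope sesquilinear_scope.

(** * Inner products, product vectors and positive semidefinite forms *)

Section InnerProduct.
Variable C : numClosedFieldType.

Definition dot n (x y : 'cV[C]_n) : C := (x ^t* *m y) 0 0.

Lemma dotE n (x y : 'cV[C]_n) : dot x y = \sum_i (x i 0)^* * y i 0.
Proof. by rewrite /dot mxE; apply: eq_bigr => i _; rewrite !mxE. Qed.

Lemma adj_mul m n p (A : 'M[C]_(m, n)) (B : 'M[C]_(n, p)) :
  (A *m B) ^t* = B ^t* *m A ^t*.
Proof. by rewrite trmx_mul map_mxM. Qed.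

Lemma dot_mx n (x y : 'cV[C]_n) : x ^t* *m y = (dot x y)%:M.
Proof. exact: mx11_scalar. Qed.

Lemma dotC n (x y : 'cV[C]_n) : (dot x y)^* = dot y x.
Proof.
rewrite !dotE rmorph_sum; apply: eq_bigr => i _.
by rewrite rmorphM /= conjCK mulrC.
Qed.

Lemma dotDr n (x y z : 'cV[C]_n) : dot x (y + z) = dot x y + dot x z.
Proof. by rewrite /dot mulmxDr mxE. Qed.

Lemma dotZr n a (x y : 'cV[C]_n) : dot x (a *: y) = a * dot x y.
Proof. by rewrite /dot -scalemxAr mxE. Qed.

Lemma dotDl n (x y z : 'cV[C]_n) : dot (x + y) z = dot x z + dot y z.
Proof. by rewrite -dotC dotDr rmorphD /= !dotC. Qed.

Lemma dotZl n a (x y : 'cV[C]_n) : dot (a *: x) y = a^* * dot x y.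
Proof. by rewrite -dotC dotZr rmorphM /= !dotC. Qed.

Lemma dot0r n (x : 'cV[C]_n) : dot x 0 = 0.
Proof. by rewrite /dot mulmx0 mxE. Qed.

Lemma dot_ge0 n (x : 'cV[C]_n) : 0 <= dot x x.
Proof. by rewrite dotE sumr_ge0 // => i _; rewrite mulrC mul_conjC_ge0. Qed.

Lemma dot_eq0 n (x : 'cV[C]_n) : (dot x x == 0) = (x == 0).
Proof.
apply/eqP/eqP => [|->]; last by rewrite dot0r.
rewrite dotE => /eqP; rewrite psumr_eq0 => [/allP x0|i _]; last first.
  by rewrite mulrC mul_conjC_ge0.
apply/colP => i; rewrite mxE; apply/eqP.
by have := x0 i (mem_index_enum i); rewrite /= mulrC mul_conjC_eq0.
Qed.

Lemma dot_adj n (A : 'M[C]_n) (x y : 'cV[C]_n) :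
  dot x (A *m y) = dot (A ^t* *m x) y.
Proof. by rewrite /dot adj_mul trmxCK mulmxA. Qed.

Lemma mul_ketbra n (x y z : 'cV[C]_n) : x *m y ^t* *m z = dot y z *: x.
Proof. by rewrite -mulmxA dot_mx mul_mx_scalar. Qed.

Lemma trace_ketbra n (x y : 'cV[C]_n) (A : 'M[C]_n) :
  \tr (x *m y ^t* *m A) = dot y (A *m x).
Proof. by rewrite -mulmxA mxtrace_mulC /mxtrace big_ord1 /dot mulmxA. Qed.

Lemma trace_outer n (x y : 'cV[C]_n) : \tr (x *m y ^t*) = dot y x.
Proof. by rewrite mxtrace_mulC /mxtrace big_ord1. Qed.

Definition orthonormal n (e : 'I_n -> 'cV[C]_n) :=
  forall a b, dot (e a) (e b) = (a == b)%:R.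

(** The matrix with columns [e a] has its adjoint as left inverse; being square, it has it as right
    inverse too. *)
Lemma orthonormal_complete n (e : 'I_n -> 'cV[C]_n) :
  orthonormal e -> \sum_a e a *m (e a) ^t* = 1%:M.
Proof.
move=> eo; pose U : 'M[C]_n := \matrix_(i, a) e a i 0.
have /mulmx1C UU : U ^t* *m U = 1%:M.
  apply/matrixP => a b; rewrite !mxE -eo dotE.
  by apply: eq_bigr => i _; rewrite !mxE.
rewrite -UU; apply/matrixP => i j; rewrite summxE !mxE.
by apply: eq_bigr => a _; rewrite !mxE big_ord1 !mxE.
Qed.

(** The tensor product has [1 * 1] columns, which is convertible to [1]; the type annotation makes
    it a column vector. *)
Definition kron m n (x : 'cV[C]_m) (y : 'cV[C]_n) : 'cV[C]_(m * n) := x *t y.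

Lemma kronE m n (x : 'cV[C]_m) (y : 'cV[C]_n) i j :
  kron x y (mxtens_index (i, j)) 0 = x i 0 * y j 0.
Proof. by rewrite mxE mxtens_indexK; congr (x _ _ * y _ _); exact: ord1. Qed.

Lemma kron_eq m n (x y : 'cV[C]_(m * n)) :
  (forall i j, x (mxtens_index (i, j)) 0 = y (mxtens_index (i, j)) 0) -> x = y.
Proof.
by move=> xy; apply/colP => k; case: (mxtens_indexP k) => i j.
Qed.

Lemma kronZl m n a (x : 'cV[C]_m) (y : 'cV[C]_n) :
  kron (a *: x) y = a *: kron x y.
Proof. by apply: kron_eq => i j; rewrite [RHS]mxE !kronE mxE mulrA. Qed.

Lemma kronZr m n a (x : 'cV[C]_m) (y : 'cV[C]_n) :
  kron x (a *: y) = a *: kron x y.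
Proof. by apply: kron_eq => i j; rewrite [RHS]mxE !kronE mxE mulrCA. Qed.

Lemma sum_mxtens m n (V : nmodType) (F : 'I_(m * n) -> V) :
  \sum_k F k = \sum_i \sum_j F (mxtens_index (i, j)).
Proof.
rewrite pair_bigA (reindex (@mxtens_index m n)) /=.
  by apply: eq_bigr => -[].
exists (@mxtens_unindex m n) => k _; first exact: mxtens_indexK.
exact: mxtens_unindexK.
Qed.

Lemma dot_kron m n (x x' : 'cV[C]_m) (y y' : 'cV[C]_n) :
  dot (kron x y) (kron x' y') = dot x x' * dot y y'.
Proof.
rewrite !dotE sum_mxtens mulr_suml; apply: eq_bigr => i _.
rewrite mulr_sumr; apply: eq_bigr => j _.
by rewrite !kronE rmorphM /= mulrACA.
Qed.

Lemma ketbra_tens m n (x x' : 'cV[C]_m) (y y' : 'cV[C]_n) :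
  (x *m x' ^t*) *t (y *m y' ^t*) = kron x y *m (kron x' y') ^t*.
Proof. by rewrite -tensmx_mul -map_mxT -trmx_tens. Qed.

(** With w = A v, the form at v - t w equals -2 t N + t^2 K, where N = |w|^2. For small t > 0 the
    linear term dominates, so positivity forces N = 0. *)
Lemma psd_kernel n (A : 'M[C]_n) (v : 'cV[C]_n) :
  A ^t* = A -> (forall w, 0 <= dot w (A *m w)) ->
  dot v (A *m v) = 0 -> A *m v = 0.
Proof.
move=> Ah Ap vAv; apply/eqP; rewrite -dot_eq0.
set w := A *m v; set N := dot w w.
have N0 : 0 <= N by exact: dot_ge0.
set K := dot w (A *m w); have K0 : 0 <= K by exact: Ap.
have vAw : dot v (A *m w) = N by rewrite dot_adj Ah.
have wAv : dot w (A *m v) = N by [].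
(* Dividing by K + 1 instead of K covers K = 0; the form then takes the value - N^2 (K + 2) / (K +
   1)^2. *)
pose t := N / (K + 1).
have K1 : 0 < K + 1 by rewrite ltr_wpDl.
have tR : t^* = t by rewrite geC0_conj // divr_ge0 // ltW.
have := Ap (v - t *: w).
rewrite -scaleNr mulmxDr -scalemxAr !(dotDl, dotDr, dotZl, dotZr).
rewrite vAw -/w -/N -/K.
rewrite vAv rmorphN /= tR.
have -> : 0 + - t * N + (- t * N + - t * (- t * K)) =
   - (N ^+ 2 * (K + 2) / (K + 1) ^+ 2).
  by rewrite /t; field; rewrite gt_eqF.
rewrite oppr_ge0 pmulr_lle0 ?invr_gt0 ?exprn_gt0 //.
rewrite pmulr_lle0 ?ltr_wpDl ?ltr0n // => NN.
have /eqP : N ^+ 2 = 0 by apply/eqP; rewrite eq_le NN exprn_ge0.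
by rewrite sqrf_eq0.
Qed.

End InnerProduct.

(** * Orthonormal bases of the qubit space and Schmidt bases *)

Section TwoDim.
Variable C : numClosedFieldType.
Implicit Types (x y : 'cV[C]_2) (e f : 'I_2 -> 'cV[C]_2).

Lemma ord2_ind (P : 'I_2 -> Prop) : P 0 -> P 1 -> forall a, P a.
Proof.
move=> P0 P1 [[|[|//]] a2].
  by have -> : Ordinal a2 = 0 by exact: val_inj.
by have -> : Ordinal a2 = 1 by exact: val_inj.
Qed.

Lemma sum_ord2 (V : nmodType) (F : 'I_2 -> V) : \sum_i F i = F 0 + F 1.
Proof.
rewrite !big_ord_recl big_ord0 addr0; congr (_ + F _); exact: val_inj.
Qed.

Lemma orthonormal2 e : dot (e 0) (e 0) = 1 -> dot (e 1) (e 1) = 1 ->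
  dot (e 0) (e 1) = 0 -> orthonormal e.
Proof.
move=> e00 e11 e01; apply: ord2_ind; apply: ord2_ind => //.
by rewrite -dotC e01 rmorph0.
Qed.

Lemma orthonormal_expand e x : orthonormal e ->
  x = dot (e 0) x *: e 0 + dot (e 1) x *: e 1.
Proof.
move=> /orthonormal_complete; rewrite sum_ord2 => e1.
by rewrite -{1}[x]mul1mx -e1 mulmxDl !mul_ketbra.
Qed.

Lemma orthonormal_rephase e w : orthonormal e -> w * w^* = 1 ->
  orthonormal (fun a => if a == 0 then e 0 else w *: e 1).
Proof.
move=> eo w1; apply: orthonormal2 => /=; rewrite ?(dotZr, dotZl) !eo ?mulr1 //.
by rewrite mulr0.
Qed.

(** For an orthonormal basis, [swap e a] spans the orthogonal complement of [e a]: kernel vectors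
    [f a] are paired below with support vectors [swap f a]. *)
Definition swap e (a : 'I_2) := if a == 0 then e 1 else e 0.

Lemma orthonormal_swap e : orthonormal e -> orthonormal (swap e).
Proof. by move=> eo; apply: orthonormal2; rewrite /swap /= eo. Qed.

Lemma swap_complete e a : orthonormal e ->
  swap e a *m (swap e a) ^t* + e a *m (e a) ^t* = 1%:M.
Proof.
move=> /orthonormal_complete; rewrite sum_ord2 => <-.
by move: a; apply: ord2_ind; rewrite /swap // addrC.
Qed.

Definition perp x : 'cV[C]_2 :=
  \col_i (if i == 0 then - (x 1 0)^* else (x 0 0)^*).

Lemma dot_perp x : dot x (perp x) = 0.
Proof. by rewrite dotE sum_ord2 !mxE /=; ring. Qed.

Lemma dot_perp_perp x : dot (perp x) (perp x) = dot x x.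
Proof. by rewrite !dotE !sum_ord2 !mxE /= rmorphN /= !conjCK; ring. Qed.

Lemma orthonormal_perp x : dot x x = 1 ->
  orthonormal (fun a : 'I_2 => if a == 0 then x else perp x).
Proof.
by move=> x1; apply: orthonormal2; rewrite /= ?dot_perp_perp ?dot_perp.
Qed.

Lemma orthonormal_extend x :
  exists e, orthonormal e /\ exists a, x = a *: e 0.
Proof.
have [->|x0] := eqVneq x 0.
  (* For x = 0 any basis serves, with scalar 0; here the standard one. *)
  exists (fun a => delta_mx a 0); split; last by exists 0; rewrite scale0r.
  by apply: orthonormal2; rewrite dotE sum_ord2 !mxE /=
    ?(rmorph1, rmorph0, mulr0, mulr1, addr0, add0r).
have r0 : sqrtC (dot x x) != 0 by rewrite sqrtC_eq0 dot_eq0.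
exists (fun a => if a == 0 then (sqrtC (dot x x))^-1 *: x
                 else perp ((sqrtC (dot x x))^-1 *: x)).
split; last by exists (sqrtC (dot x x)); rewrite /= scalerA divff // scale1r.
apply: orthonormal_perp; rewrite dotZr dotZl geC0_conj; last first.
  by rewrite invr_ge0 sqrtC_ge0 dot_ge0.
by rewrite mulrA -invfM -expr2 sqrtCK mulVf // dot_eq0.
Qed.

(* With A the coefficient matrix of psi, <x (x) y, psi> = <y, A conj(x)>; an
   eigenbasis d of A^* A makes A d_0 and A d_1 orthogonal, and f is chosen
   along these two vectors. *)
Lemma schmidt_basis (psi : 'cV[C]_(2 * 2)) : exists e f,
  [/\ orthonormal e, orthonormal f & forall a, dot (kron (e a) (f a)) psi = 0].
Proof.
pose A : 'M[C]_2 := \matrix_(j, i) psi (mxtens_index (i, j)) 0.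
pose cj x : 'cV[C]_2 := map_mx Num.conj x.
have psiE x y : dot (kron x y) psi = dot y (A *m cj x).
  rewrite !dotE sum_mxtens exchange_big; apply: eq_bigr => j _ /=.
  rewrite mxE mulr_sumr; apply: eq_bigr => i _.
  by rewrite kronE !mxE rmorphM /=; ring.
(* [v] is a left eigenvector, hence a row; its adjoint spans the direction of [d 0]. *)
have [la /eigenvalueP[v vA v0]] := eigenvalue_closed (A ^t* *m A) isT.
have [d [don [al ve]]] := orthonormal_extend (v ^t*).
have al0 : al != 0.
  apply: contra_neq v0 => al0; rewrite -[v]trmxCK ve al0 scale0r.
  by rewrite trmx0 map_mx0.
have AdAd : dot (A *m d 0) (A *m d 1) = 0.
  apply/(mulfI (x := al^*)); first by rewrite conjC_eq0.
  rewrite mulr0 -dotZl scalemxAr -ve /dot adj_mul trmxCK.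
  rewrite !mulmxA -[v *m _ *m _]mulmxA.
  rewrite vA -scalemxAl mxE -[v]trmxCK ve.
  by rewrite -/(dot _ _) dotZl don !mulr0.
pose e a := cj (d a).
have eo : orthonormal e.
  have dE a b : dot (e a) (e b) = (dot (d a) (d b))^*.
    rewrite !dotE rmorph_sum; apply: eq_bigr => i _.
    by rewrite !mxE rmorphM /= conjCK.
  by move=> a b; rewrite dE don conjC_nat.
have ecj a : cj (e a) = d a by apply/colP => i; rewrite !mxE conjCK.
(* If A d_0 = 0 it gives no direction, so f is built on A d_1, which may vanish too. Otherwise [f 0]
   lies along A d_0, and the swap pairs each A d_a with a vector orthogonal to it. *)
have [w0|w0] := eqVneq (A *m d 0) 0.
  have [f [fo [be w1]]] := orthonormal_extend (A *m d 1).
  exists e, f; split=> //.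
  apply: ord2_ind; rewrite psiE ecj /= ?w0 ?dot0r //.
  by rewrite w1 dotZr fo mulr0.
have [f [fo [be we]]] := orthonormal_extend (A *m d 0).
have be0 : be != 0 by apply: contra_neq w0; rewrite we => ->; rewrite scale0r.
exists e, (swap f); split=> //.
  exact: orthonormal_swap.
apply: ord2_ind; rewrite psiE ecj /swap /=; first by rewrite we dotZr fo mulr0.
apply/(mulfI (x := be^*)); first by rewrite conjC_eq0.
by rewrite mulr0 -dotZl -we.
Qed.

End TwoDim.

(** * Expansion of a Hermitian matrix that kills given product vectors *)

Section Support.
Variable C : numClosedFieldType.

Lemma tens_suml m n k (F : 'I_k -> 'M[C]_m) (B : 'M[C]_n) :
  (\sum_a F a) *t B = \sum_a F a *t B.
Proof.
apply/matrixP => i j; rewrite mxE !summxE mulr_suml.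
by apply: eq_bigr => a _; rewrite mxE.
Qed.

Lemma tensDr m n (A : 'M[C]_m) (B B' : 'M[C]_n) :
  A *t (B + B') = A *t B + A *t B'.
Proof. by apply/matrixP => i j; rewrite !mxE mulrDr. Qed.

Lemma tens1 m n : 1%:M *t 1%:M = 1%:M :> 'M[C]_(m * n).
Proof.
apply/matrixP => i j; case: (mxtens_indexP i) => i1 i2.
case: (mxtens_indexP j) => j1 j2.
rewrite tensmxE !mxE (can_eq (@mxtens_indexK _ _)) xpair_eqE -natrM.
by rewrite mulnb.
Qed.

(** Insert the identity sum_a e_a e_a^* (x) (phi_a phi_a^* + g_a g_a^* ) to the right of [rho]: the
    g terms die, so rho = rho P with P = sum_a u_a u_a^*. Taking adjoints gives rho = P rho P. *)
Lemma support_decomposition m n (rho : 'M[C]_(m * n))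
    (e : 'I_m -> 'cV[C]_m) (phi g : 'I_m -> 'cV[C]_n) :
  rho ^t* = rho -> orthonormal e ->
  (forall a, phi a *m (phi a) ^t* + g a *m (g a) ^t* = 1%:M) ->
  (forall a, rho *m kron (e a) (g a) = 0) ->
  let u a := kron (e a) (phi a) in
  rho = \sum_a \sum_b dot (u a) (rho *m u b) *: (u a *m (u b) ^t*).
Proof.
move=> rhoh eo phig rg u; pose P := \sum_a u a *m (u a) ^t*.
have rP : rho = rho *m P.
  rewrite -[LHS]mulmx1 -tens1 -(orthonormal_complete eo) tens_suml !mulmx_sumr.
  apply: eq_bigr => a _; rewrite -(phig a) tensDr mulmxDr !ketbra_tens.
  by rewrite [X in _ + X]mulmxA rg mul0mx addr0.
have Ph : P ^t* = P.
  rewrite /P raddf_sum map_mx_sum /=; apply: eq_bigr => a _.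
  by rewrite adj_mul trmxCK.
have Pr : rho = P *m rho by rewrite -{1}rhoh {1}rP adj_mul rhoh Ph.
rewrite {1}Pr {1}rP mulmx_suml; apply: eq_bigr => a _.
rewrite mulmxA mulmx_sumr; apply: eq_bigr => b _.
transitivity (u a *m ((u a) ^t* *m (rho *m u b)) *m (u b) ^t*).
  by rewrite !mulmxA.
by rewrite dot_mx mul_mx_scalar -scalemxAl.
Qed.

Lemma support_decomposition2 n (rho : 'M[C]_(2 * n))
    (e : 'I_2 -> 'cV[C]_2) (phi g : 'I_2 -> 'cV[C]_n) :
  rho ^t* = rho -> orthonormal e ->
  (forall a, phi a *m (phi a) ^t* + g a *m (g a) ^t* = 1%:M) ->
  (forall a, rho *m kron (e a) (g a) = 0) ->
  let u a := kron (e a) (phi a) in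
  let c a b := dot (u a) (rho *m u b) in
  rho = c 0 0 *: (u 0 *m (u 0) ^t*) + c 0 1 *: (u 0 *m (u 1) ^t*)
      + (c 1 0 *: (u 1 *m (u 0) ^t*) + c 1 1 *: (u 1 *m (u 1) ^t*)).
Proof.
move=> rhoh eo phig rg u c.
by rewrite {1}(support_decomposition rhoh eo phig rg) !sum_ord2.
Qed.

Lemma support_decomposition_diag n (rho : 'M[C]_(2 * n))
    (e : 'I_2 -> 'cV[C]_2) (phi g : 'I_2 -> 'cV[C]_n) :
  rho ^t* = rho -> orthonormal e ->
  (forall a, phi a *m (phi a) ^t* + g a *m (g a) ^t* = 1%:M) ->
  (forall a, rho *m kron (e a) (g a) = 0) ->
  let u a := kron (e a) (phi a) in
  dot (u 0) (rho *m u 1) = 0 ->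
  rho = \sum_a dot (u a) (rho *m u a) *: (u a *m (u a) ^t*).
Proof.
move=> rhoh eo phig rg u c01.
have c10 : dot (u 1) (rho *m u 0) = 0 by rewrite dot_adj rhoh -dotC c01 rmorph0.
rewrite {1}(support_decomposition2 rhoh eo phig rg) sum_ord2 c01 c10.
by rewrite !scale0r addr0 add0r.
Qed.

Lemma dot_two_by_two n (u0 u1 v : 'cV[C]_n) (c00 c01 c10 c11 : C) :
  dot v ((c00 *: (u0 *m u0 ^t*) + c01 *: (u0 *m u1 ^t*)
        + (c10 *: (u1 *m u0 ^t*) + c11 *: (u1 *m u1 ^t*))) *m v) =
  c00 * (dot u0 v * (dot u0 v)^* ) + c01 * (dot u1 v * (dot u0 v)^* )
  + (c10 * (dot u0 v * (dot u1 v)^* ) + c11 * (dot u1 v * (dot u1 v)^* )).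
Proof.
by rewrite !mulmxDl -!scalemxAl !mul_ketbra !(dotDr, dotZr) !dotC.
Qed.

(** With both local bases orthonormal, the support vectors play the roles of |00> and |11>. They are
    orthonormal, whence the trace formula. *)
Lemma xstate_decomposition (rho : 'M[C]_(2 * 2)) (e f : 'I_2 -> 'cV[C]_2) :
  rho ^t* = rho -> orthonormal e -> orthonormal f ->
  (forall a, rho *m kron (e a) (f a) = 0) ->
  let c := dot (kron (e 0) (swap f 0)) (rho *m kron (e 1) (swap f 1)) in
  c != 0 ->
  exists2 e', orthonormal e' & let u a := kron (e' a) (swap f a) in
  let p a := dot (u a) (rho *m u a) in
  \tr rho = p 0 + p 1 /\
  rho = p 0 *: (u 0 *m (u 0) ^t*) + `|c| *: (u 0 *m (u 1) ^t*)
      + (`|c| *: (u 1 *m (u 0) ^t*) + p 1 *: (u 1 *m (u 1) ^t*)).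
Proof.
move=> rhoh eo fo rk c c0.
(* The phase of c is absorbed in e' 1. *)
pose w := c^* / `|c|; pose e' (a : 'I_2) := if a == 0 then e 0 else w *: e 1.
have nc0 : `|c| != 0 by rewrite normr_eq0.
have nc : `|c|^* = `|c| by rewrite geC0_conj.
have w1 : w * w^* = 1.
  rewrite /w rmorphM /= conjCK fmorphV /= nc mulrACA [c^* * c]mulrC -normCK.
  by rewrite -invfM -expr2 divff // expf_neq0.
have eo' : orthonormal e' by exact: orthonormal_rephase.
have rk' : forall a, rho *m kron (e' a) (f a) = 0.
  by apply: ord2_ind; rewrite /e' /= ?kronZl -?scalemxAr rk ?scaler0.
have c01 : dot (kron (e' 0) (swap f 0)) (rho *m kron (e' 1) (swap f 1)) = `|c|.
  rewrite /e' /= kronZl -scalemxAr dotZr -/c /w mulrAC [_ * c]mulrC -normCK.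
  by rewrite expr2 mulfK.
have c10 : dot (kron (e' 1) (swap f 1)) (rho *m kron (e' 0) (swap f 0)) = `|c|.
  by rewrite dot_adj rhoh -dotC c01 nc.
exists e' => // u p.
have rhoE : rho = p 0 *: (u 0 *m (u 0) ^t*) + `|c| *: (u 0 *m (u 1) ^t*)
      + (`|c| *: (u 1 *m (u 0) ^t*) + p 1 *: (u 1 *m (u 1) ^t*)).
  rewrite -{1}c01 -c10.
  by apply: support_decomposition2 => // a; exact: swap_complete.
split; last exact: rhoE.
have phio := orthonormal_swap fo.
rewrite {1}rhoE !mxtraceD !mxtraceZ !trace_outer !dot_kron !eo' !phio /=.
by rewrite !(mulr0, mulr1, addr0, add0r).
Qed.

End Support.

(** * From steering kernels to two orthogonal product vectors in the kernel *)

Section Dichotomy.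
Variable C : numClosedFieldType.

(** In dimension two, a vector orthogonal to [F 1] is a multiple of [F 0]. *)
Lemma orthogonal_vector_kernel (rho : 'M[C]_(2 * 2)) (d x : 'cV[C]_2)
    (F : 'I_2 -> 'cV[C]_2) :
  orthonormal F -> rho *m kron d (F 0) = 0 -> dot (F 1) x = 0 ->
  rho *m kron d x = 0.
Proof.
move=> Fo rF Fx; rewrite (orthonormal_expand x Fo) Fx scale0r addr0.
by rewrite kronZr -scalemxAr rF scaler0.
Qed.

Lemma orthogonal_kernel_exists (rho : 'M[C]_(2 * 2)) (e f h : 'I_2 -> 'cV[C]_2)
    (F : 'I_2 -> 'I_2 -> 'cV[C]_2) :
  rho ^t* = rho -> orthonormal e -> (forall a, orthonormal (F a)) ->
  (forall a, rho *m kron (e a) (F a 0) = 0) ->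
  dot (kron (e 0) (F 0 1)) (rho *m kron (e 1) (F 1 1)) != 0 ->
  orthonormal f -> (forall b, h b != 0) ->
  (forall b, rho *m kron (h b) (f b) = 0) ->
  exists e' f', [/\ orthonormal e', orthonormal f' &
    forall a, rho *m kron (e' a) (f' a) = 0].
Proof.
move=> rhoh eo Fo rF c01n fo hn0 rf.
have Fc a : F a 1 *m (F a 1) ^t* + F a 0 *m (F a 0) ^t* = 1%:M.
  by have := orthonormal_complete (Fo a); rewrite sum_ord2 addrC.
pose u a := kron (e a) (F a 1).
pose c a b := dot (u a) (rho *m u b).
have cC a b : (c a b)^* = c b a by rewrite /c dotC dot_adj rhoh.
have rhoE v : rho *m v = (c 0 0 * dot (u 0) v + c 0 1 * dot (u 1) v) *: u 0
                       + (c 1 0 * dot (u 0) v + c 1 1 * dot (u 1) v) *: u 1.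
  rewrite {1}(support_decomposition2 rhoh eo Fc rF) !mulmxDl -!scalemxAl.
  by rewrite !mul_ketbra !scalerA -!scalerDl.
have uo a b : dot (u a) (u b) = (a == b)%:R.
  rewrite dot_kron eo; have [<-|_] := eqVneq a b; last by rewrite mul0r.
  by rewrite Fo eqxx mulr1.
have [D0|D0] := eqVneq (c 0 0 * c 1 1) (c 0 1 * c 1 0).
  (* If c_00 = 0, the vanishing determinant gives |c_01|^2 = 0. *)
  have c00 : c 0 0 != 0.
    apply: contra_neq c01n => c00; have := D0; rewrite c00 mul0r => /esym/eqP.
    by rewrite -[c 1 0]cC mul_conjC_eq0 => /eqP.
  (* The coefficient matrix has rank one, so its first column spans the range of [rho]; by
     Hermiticity every vector orthogonal to it lies in the kernel. *)
  have [e' [f' [eo' fo' ef]]] := schmidt_basis (c 0 0 *: u 0 + c 1 0 *: u 1).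
  exists e', f'; split=> // a.
  have : dot (c 0 0 *: u 0 + c 1 0 *: u 1) (kron (e' a) (f' a)) = 0.
    by rewrite -dotC ef rmorph0.
  rewrite dotDl !dotZl !cC rhoE => x0; rewrite x0 scale0r add0r.
  move: (dot (u 0) _) (dot (u 1) _) x0 => x y xy.
  suff -> : c 1 0 * x + c 1 1 * y = 0 by rewrite scale0r.
  apply: (mulfI c00); rewrite mulr0 mulrDr [c 0 0 * (c 1 1 * _)]mulrA D0.
  have -> : c 0 0 * (c 1 0 * x) + c 0 1 * c 1 0 * y =
    c 1 0 * (c 0 0 * x + c 0 1 * y).
    by ring.
  by rewrite xy mulr0.
(* The determinant is nonzero: Cramer's rule solves for both overlaps. *)
have kerE v : rho *m v = 0 -> dot (u 0) v = 0 /\ dot (u 1) v = 0.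
  move=> rv; have := congr1 (dot (u 0)) rv; have := congr1 (dot (u 1)) rv.
  rewrite rhoE !dot0r !dotDr !dotZr !uo /= !(mulr0, mulr1, addr0, add0r).
  move: (dot (u 0) v) (dot (u 1) v) => x y xy1 xy0.
  have D0' : c 0 0 * c 1 1 - c 0 1 * c 1 0 != 0 by rewrite subr_eq0.
  split; apply: (mulfI D0'); rewrite mulr0.
    have -> : (c 0 0 * c 1 1 - c 0 1 * c 1 0) * x =
      c 1 1 * (c 0 0 * x + c 0 1 * y) - c 0 1 * (c 1 0 * x + c 1 1 * y) by ring.
    by rewrite xy0 xy1 !mulr0 subr0.
  have -> : (c 0 0 * c 1 1 - c 0 1 * c 1 0) * y =
    c 0 0 * (c 1 0 * x + c 1 1 * y) - c 1 0 * (c 0 0 * x + c 0 1 * y) by ring.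
  by rewrite xy0 xy1 !mulr0 subr0.
(* Each column of z has a zero, since [h b] is not orthogonal to both e_a ([some]); no row has two,
   since [F a 1] is not orthogonal to both f_b ([notall]). So the zeros of z form exactly the
   diagonal or the antidiagonal. *)
pose z a b := dot (F a 1) (f b).
have some b : (z 0 b == 0) || (z 1 b == 0).
  have [] := kerE _ (rf b); rewrite !dot_kron => /eqP + /eqP.
  rewrite !mulf_eq0 -/(z 0 b) -/(z 1 b).
  case: (z 0 b == 0); case: (z 1 b == 0) => //.
  rewrite !orbF => /eqP h0 /eqP h1.
  by have := hn0 b; rewrite (orthonormal_expand (h b) eo) h0 h1 !scale0r addr0
    eqxx.
have notall a : ~~ ((z a 0 == 0) && (z a 1 == 0)).
  apply/negP => /andP[/eqP z0 /eqP z1].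
  have /eqP := Fo a 1 1; rewrite {2}(orthonormal_expand (F a 1) fo).
  rewrite dotDr !dotZr -/(z a 0) -/(z a 1) z0 z1 !mulr0 addr0 eqxx eq_sym.
  by rewrite oner_eq0.
have ker a b : z a b == 0 -> rho *m kron (e a) (f b) = 0.
  by move=> /eqP; exact: orthogonal_vector_kernel.
have := some 0; have := some 1; have := notall 0; have := notall 1.
case z00 : (z 0 0 == 0) => /=; case z11 : (z 1 1 == 0) => /=.
- by exists e, f; split=> //; apply: ord2_ind; apply: ker.
- by case: (z 0 1 == 0) => //; case: (z 1 0 == 0).
- by case z10 : (z 1 0 == 0).
case z10 : (z 1 0 == 0) => //; case z01 : (z 0 1 == 0) => // *.
by exists e, (swap f); split=> //; [exact: orthonormal_swap|];
  apply: ord2_ind; apply: ker.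
Qed.

(** [kermx] yields a row v with v A = 0; [F 0] is taken along its adjoint, which makes the quadratic
    form of A vanish there. *)
Lemma singular_kernel (A : 'M[C]_2) : \rank A = 1%N ->
  exists2 F, orthonormal F & dot (F 0) (A *m F 0) = 0.
Proof.
move=> rA; have : kermx A != 0.
  by rewrite kermx_eq0 row_free_unit -row_full_unit /row_full rA.
case/rowV0Pn => v /sub_kermxP vA v0.
have [F [Fo [al vE]]] := orthonormal_extend (v ^t*).
have al0 : al != 0.
  apply: contra_neq v0 => al0; rewrite -[v]trmxCK vE al0 scale0r.
  by rewrite trmx0 map_mx0.
exists F => //; apply/(mulfI (x := al^*)); first by rewrite conjC_eq0.
by rewrite mulr0 -dotZl -vE /dot trmxCK mulmxA vA mul0mx mxE.
Qed.

End Dichotomy.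

Local Open Scope complex_scope.

(** * The CHSH inequality for local hidden variable models *)

Section CHSH.
Variable R : realType.

(** Outcome 0 counts as +1 and outcome 1 as -1. *)
Definition correlator (p : 'I_2 -> 'I_2 -> 'I_2 -> 'I_2 -> R[i]) i j : R[i] :=
  p i j 0 0 - p i j 0 1 - p i j 1 0 + p i j 1 1.

Definition chsh (p : 'I_2 -> 'I_2 -> 'I_2 -> 'I_2 -> R[i]) : R[i] :=
  correlator p 0 0 + correlator p 0 1 + correlator p 1 0 - correlator p 1 1.

(** The left side is x0 (y0 + y1) + x1 (y0 - y1), at most |y0 + y1| + |y0 - y1| = 2 max(|y0|,
    |y1|). *)
Lemma chsh_pointwise (x0 x1 y0 y1 : R) :
  -1 <= x0 <= 1 -> -1 <= x1 <= 1 -> -1 <= y0 <= 1 -> -1 <= y1 <= 1 ->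
  x0 * y0 + x0 * y1 + x1 * y0 - x1 * y1 <= 2.
Proof.
move=> /andP[? ?] /andP[? ?] /andP[? ?] /andP[? ?].
have [?|?] := leP 0 (y0 + y1); have [?|?] := leP 0 (y0 - y1); nra.
Qed.

Lemma integrable_mul_bounded d (T : measurableType d) (mu : probability T R)
    (f g : T -> R) :
  measurable_fun [set: T] f -> measurable_fun [set: T] g ->
  (forall l, -1 <= f l <= 1) -> (forall l, -1 <= g l <= 1) ->
  mu.-integrable [set: T] (EFin \o (fun l => f l * g l)).
Proof.
move=> mf mg f1 g1; apply: measurable_bounded_integrable => //.
- by apply: fin_num_fun_lty; exact: fin_num_measure.
- exact: measurable_funM.
- exists 1; split; first exact: num_real.
  move=> M M1 l _ /=; apply: le_trans (ltW M1).
  by rewrite normrM mulr_ile1 // ler_norml.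
Qed.

(** At a fixed hidden variable the mean outcomes x_i and y_j lie in [-1, 1], and each correlator is
    the integral of x_i y_j; integrate the pointwise bound. *)
Lemma chsh_lhv p : has_lhv_model p -> chsh p <= 2.
Proof.
move=> [d [T [mu [pA [pB [[mA mB] pA1 pB1 pE]]]]]].
pose x i l := pA i 0 l - pA i 1 l; pose y j l := pB j 0 l - pB j 1 l.
have xm i : measurable_fun [set: T] (x i) by exact: measurable_funB.
have ym j : measurable_fun [set: T] (y j) by exact: measurable_funB.
have bnd (q : 'I_2 -> T -> R) l :
    (forall a, 0 <= q a l) /\ \sum_a q a l = 1 ->
    (forall a, -1 <= q a l <= 1) /\ -1 <= q 0 l - q 1 l <= 1.
  case=> q0; rewrite sum_ord2 => q1.
  have := q0 0; have := q0 1 => ? ?.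
  split; last by apply/andP; split; lra.
  by apply: ord2_ind; apply/andP; split; lra.
have xb i l : -1 <= x i l <= 1 by have [] := bnd _ _ (pA1 i l).
have yb j l : -1 <= y j l <= 1 by have [] := bnd _ _ (pB1 j l).
have pint i j a b :
    mu.-integrable [set: T] (EFin \o (fun l => pA i a l * pB j b l)).
  apply: integrable_mul_bounded => // l.
    by have [] := bnd _ _ (pA1 i l).
  by have [] := bnd _ _ (pB1 j l).
have xyint i j : mu.-integrable [set: T] (EFin \o (fun l => x i l * y j l)).
  exact: integrable_mul_bounded.
pose I (f : T -> R) := Rintegral mu [set: T]%classic f.
pose L1 (f : T -> R) := mu.-integrable [set: T]%classic (EFin \o f).
(* Integrability is returned with the equation so that four-term sums can be chained. *)
have ID f g : L1 f -> L1 g -> L1 (f \+ g) /\ I f + I g = I (f \+ g).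
  move=> fi gi; split; first exact: (integrableD _ fi gi).
  by rewrite /I RintegralD.
have IB f g : L1 f -> L1 g -> L1 (f \- g) /\ I f - I g = I (f \- g).
  move=> fi gi; split; first exact: (integrableB _ fi gi).
  by rewrite /I RintegralB.
have cE i j : correlator p i j = (I (x i \* y j))%:C.
  have [i1 e1] := IB _ _ (pint i j 0 0) (pint i j 0 1).
  have [i2 e2] := IB _ _ i1 (pint i j 1 0).
  have [i3 e3] := ID _ _ i2 (pint i j 1 1).
  rewrite /correlator !pE -!(rmorphB, rmorphD) /= -/(I _) -!/(I _) e1 e2 e3.
  by congr (I _)%:C; apply/funext => l /=; rewrite /x /y; ring.
have [i1 e1] := ID _ _ (xyint 0 0) (xyint 0 1).
have [i2 e2] := ID _ _ i1 (xyint 1 0).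
have [i3 e3] := IB _ _ i2 (xyint 1 1).
rewrite /chsh !cE -!(rmorphB, rmorphD) /= e1 e2 e3.
have -> : 2 = (I (cst 2))%:C :> R[i].
  rewrite /I Rintegral_cst // [X in fine X](_ : _ = 1%E).
    by rewrite mulr1 rmorphD rmorph1.
  exact: probability_setT.
rewrite lecR; apply: le_Rintegral => //.
- exact: finite_measure_integrable_cst.
- by move=> l _; exact: chsh_pointwise.
Qed.

End CHSH.

(** * Separability criterion and measurements from orthonormal bases *)

Section States.
Variable R : realType.
Local Notation C := R[i].

Lemma hermP n (A : 'M[C]_n) : A \is hermsymmx <-> A ^t* = A.
Proof.
split=> [/is_hermitianmxP|] h; first by rewrite {2}h expr0 scale1r.
by apply/is_hermitianmxP; rewrite expr0 scale1r h.
Qed.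

Lemma conj_RtoC (x : R) : ((x%:C)^*)%R = x%:C.
Proof. exact: conjc_real. Qed.

Lemma psdP n (A : 'M[C]_n) :
  psdmx A -> A ^t* = A /\ forall v : 'cV[C]_n, 0 <= dot v (A *m v).
Proof.
by case=> /hermP Ah Ap; split=> // v; rewrite /dot mulmxA.
Qed.

Lemma is_state_ketbra n (x : 'cV[C]_n) : dot x x = 1 -> is_state (x *m x ^t*).
Proof.
move=> x1; split; last by rewrite trace_outer.
split; first by apply/hermP; rewrite adj_mul trmxCK.
move=> v; rewrite mulmxA -mulmxA mxE big_ord1 -/(dot _ _) -/(dot _ _).
by rewrite -[dot x v]dotC mul_conjC_ge0.
Qed.

(** Without the off-diagonal term, [rho] is a mixture of the two product projectors u_a u_a^*; the
    weights c_aa are nonnegative by positivity and sum to the trace. *)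
Lemma rank_one_support_separable (rho : 'M[C]_(2 * 2))
    (e phi g : 'I_2 -> 'cV[C]_2) :
  is_state rho -> orthonormal e -> (forall a, dot (phi a) (phi a) = 1) ->
  (forall a, phi a *m (phi a) ^t* + g a *m (g a) ^t* = 1%:M) ->
  (forall a, rho *m kron (e a) (g a) = 0) ->
  dot (kron (e 0) (phi 0)) (rho *m kron (e 1) (phi 1)) = 0 ->
  is_separable rho.
Proof.
move=> [/psdP[rhoh rhop] tr1] eo phi1 phig rg c01.
pose u a := kron (e a) (phi a).
pose c a b := dot (u a) (rho *m u b).
have rhoE : rho = \sum_a c a a *: (u a *m (u a) ^t*).
  exact: support_decomposition_diag rhoh eo phig rg c01.
have [w wE] : exists w : 'I_2 -> R, forall a, c a a = (w a)%:C.
  exists (fun a => complex.Re (c a a)) => a.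
  by rewrite RRe_real // ger0_real // rhop.
have w0 a : 0 <= w a by rewrite -ler0c -wE rhop.
have {}rhoE : rho = \sum_a (w a)%:C *: (u a *m (u a) ^t*).
  by rewrite rhoE; apply: eq_bigr => a _; rewrite wE.
exists 2%N, w, (fun a => e a *m (e a) ^t*), (fun a => phi a *m (phi a) ^t*).
split.
- exact: w0.
- apply: (@complexI R); rewrite rmorph1 -tr1 rhoE !raddf_sum.
  apply: eq_bigr => a _; rewrite /= mxtraceZ trace_outer.
  by rewrite /u !dot_kron !eo !phi1 eqxx !mulr1.
- by move=> a; split; apply: is_state_ketbra; rewrite ?eo ?eqxx.
- by rewrite {1}rhoE; apply: eq_bigr => a _; rewrite ketbra_tens.
Qed.

(** This allows measurement settings to be specified by their eigenbases alone. *)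
Lemma proj_meas_exists (d : 'I_2 -> 'cV[C]_2) : orthonormal d ->
  exists n, is_proj_meas n (fun a => d a *m (d a) ^t*).
Proof.
move=> dO; have d00 := dO 0 0; have dc := orthonormal_complete dO.
rewrite sum_ord2 in dc; rewrite dotE sum_ord2 /= in d00.
pose x1 := complex.Re (d 0 0 0); pose x2 := complex.Im (d 0 0 0).
pose y1 := complex.Re (d 0 1 0); pose y2 := complex.Im (d 0 1 0).
have xE k : d 0 0 k = x1 +i* x2 by rewrite (ord1 k) /x1 /x2; case: (d 0 0 0).
have yE k : d 0 1 k = y1 +i* y2 by rewrite (ord1 k) /y1 /y2; case: (d 0 1 0).
have n1 : x1 ^+ 2 + x2 ^+ 2 + y1 ^+ 2 + y2 ^+ 2 = 1.
  by move: d00; rewrite xE yE => -[<- _]; ring.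
(* The Bloch vector of d 0. *)
pose n : 'rV[R]_3 := \row_k
  (if k == 0 then 2 * (x1 * y1 + x2 * y2)
   else if k == 1 then 2 * (x1 * y2 - x2 * y1)
   else x1 ^+ 2 + x2 ^+ 2 - y1 ^+ 2 - y2 ^+ 2).
have nE : pauli_dot n = d 0 *m (d 0) ^t* - d 1 *m (d 1) ^t*.
(* Completeness eliminates [d 1], leaving identities in the entries of [d 0]. *)
{ have -> : d 1 *m (d 1) ^t* = 1%:M - d 0 *m (d 0) ^t*.
    by rewrite -dc [RHS]addrC addKr.
  apply/matrixP; apply: ord2_ind; apply: ord2_ind; rewrite !mxE !big_ord1 !mxE;
    rewrite ?xE ?yE /=; apply/eqP; rewrite eq_complex /=; apply/andP; split;
    apply/eqP.
  all: lra. }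
have nn : \sum_k n 0 k ^+ 2 = 1.
  (* The squared length of the Bloch vector is the fourth power of the norm of [d 0]. *)
  have -> : 1 = (x1 ^+ 2 + x2 ^+ 2 + y1 ^+ 2 + y2 ^+ 2) ^+ 2.
    by rewrite n1 expr1n.
  by rewrite !big_ord_recl big_ord0 !mxE /=; ring.
exists n; split=> //.
exists d; split=> //.
- by move=> a b; rewrite dot_mx dO.
- move=> a; rewrite nE mulmxBl !mul_ketbra !dO; move: a.
  by apply: ord2_ind;
    rewrite !(scale0r, scale1r, subr0, sub0r, expr0, expr1, scaleN1r).
Qed.

End States.

(** * CHSH violation by the canonical form *)

Section Canonical.
Variable R : realType.
Local Notation C := R[i].

(** Coordinates as functions of the outcome, so that one probability formula covers both
    outcomes. *)
Definition rot0 (x y : R) (a : 'I_2) : R := if a == 0 then x else - y.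
Definition rot1 (x y : R) (a : 'I_2) : R := if a == 0 then y else x.

(** For x = cos(t/2) and y = sin(t/2) this is the eigenbasis of cos t Z + sin t X, with Z and X
    taken relative to [e]. *)
Definition rotate (e : 'I_2 -> 'cV[C]_2) (x y : R) (a : 'I_2) : 'cV[C]_2 :=
  (rot0 x y a)%:C *: e 0 + (rot1 x y a)%:C *: e 1.

Lemma orthonormal_rotate (e : 'I_2 -> 'cV[C]_2) (x y : R) : orthonormal e ->
  x ^+ 2 + y ^+ 2 = 1 -> orthonormal (rotate e x y).
Proof.
move=> eo xy; apply: orthonormal2; rewrite /rotate /rot0 /rot1 /=
    !(dotDl, dotDr, dotZl, dotZr) !eo /=;
  rewrite !conj_RtoC !(mulr0, mulr1, addr0, add0r) -!rmorphM -rmorphD /=;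
  rewrite -?(rmorph1 (real_complex R)) -?(rmorph0 (real_complex R));
  congr (_%:C); rewrite -?xy; ring.
Qed.

Lemma xstate_prob (rho : 'M[C]_(2 * 2)) (e f : 'I_2 -> 'cV[C]_2)
    (p0 p1 r x y x' y' : R) :
  orthonormal e -> orthonormal f ->
  (let u a := kron (e a) (f a) in
   rho = p0%:C *: (u 0 *m (u 0) ^t*) + r%:C *: (u 0 *m (u 1) ^t*)
       + (r%:C *: (u 1 *m (u 0) ^t*) + p1%:C *: (u 1 *m (u 1) ^t*))) ->
  let v := kron (x%:C *: e 0 + y%:C *: e 1) (x'%:C *: f 0 + y'%:C *: f 1) in
  dot v (rho *m v) =
  (p0 * (x * x') ^+ 2 + p1 * (y * y') ^+ 2 + 2 * r * (x * x') * (y * y'))%:C.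
Proof.
move=> eo fo /=.
set u0 := kron (e 0) (f 0); set u1 := kron (e 1) (f 1) => -> /=.
set v := kron (_ + _) _.
have v0 : dot u0 v = (x * x')%:C.
  rewrite dot_kron !(dotDr, dotZr) !eo !fo /=.
  by rewrite !(mulr0, mulr1, addr0) -rmorphM.
have v1 : dot u1 v = (y * y')%:C.
  rewrite dot_kron !(dotDr, dotZr) !eo !fo /=.
  by rewrite !(mulr0, mulr1, add0r) -rmorphM.
rewrite dot_two_by_two v0 v1 !conj_RtoC -!(rmorphM, rmorphD) /=.
by congr (_%:C); ring.
Qed.

Lemma xstate_violates (rho : 'M[C]_(2 * 2)) (e f : 'I_2 -> 'cV[C]_2)
    (p0 p1 r : R) :
  orthonormal e -> orthonormal f -> p0 + p1 = 1 -> 0 < r ->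
  (let u a := kron (e a) (f a) in
   rho = p0%:C *: (u 0 *m (u 0) ^t*) + r%:C *: (u 0 *m (u 1) ^t*)
       + (r%:C *: (u 1 *m (u 0) ^t*) + p1%:C *: (u 1 *m (u 1) ^t*))) ->
  violates_local_realism rho.
Proof.
move=> eo fo p01 r0 rhoE.
(* Half-angle coordinates: Alice measures Z and X, Bob measures
   (1 + r ^ 2)^-1 ((1 - r ^ 2) Z +- 2 r X), and the CHSH value is
   2 (1 + 3 r ^ 2) / (1 + r ^ 2). *)
pose h : R := Num.sqrt (2^-1).
have h2 : h ^+ 2 = 2^-1 by rewrite sqr_sqrtr // invr_ge0 ler0n.
have r1 : 0 < 1 + r ^+ 2 by rewrite ltr_pwDl // sqr_ge0.
pose k : R := Num.sqrt ((1 + r ^+ 2)^-1).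
have k2 : k ^+ 2 = (1 + r ^+ 2)^-1 by rewrite sqr_sqrtr // invr_ge0 ltW.
have k2r : k ^+ 2 * (1 + r ^+ 2) = 1 by rewrite k2 mulVf // gt_eqF.
pose xA (i : 'I_2) : R := if i == 0 then 1 else h.
pose yA (i : 'I_2) : R := if i == 0 then 0 else h.
pose yB (j : 'I_2) : R := if j == 0 then k * r else - (k * r).
have xyA i : xA i ^+ 2 + yA i ^+ 2 = 1.
  rewrite /xA /yA; case: eqP => _; first by rewrite expr1n expr0n addr0.
  by rewrite h2; field.
have xyB j : k ^+ 2 + yB j ^+ 2 = 1.
  by rewrite /yB; case: eqP => _; rewrite -k2r; ring.
pose dA i := rotate e (xA i) (yA i); pose dB j := rotate f k (yB j).
have dAo i : orthonormal (dA i) by exact: orthonormal_rotate.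
have dBo j : orthonormal (dB j) by exact: orthonormal_rotate.
have [nA nAP] := boolp.choice (fun i => proj_meas_exists (dAo i)).
have [nB nBP] := boolp.choice (fun j => proj_meas_exists (dBo j)).
exists 2%N, 2%N, nA, nB, (fun i a => dA i a *m (dA i a) ^t*),
  (fun j b => dB j b *m (dB j b) ^t*); split=> //.
set p := fun i j a b => _ => /chsh_lhv.
have pE i j a b : p i j a b =
    (p0 * (rot0 (xA i) (yA i) a * rot0 k (yB j) b) ^+ 2
     + p1 * (rot1 (xA i) (yA i) a * rot1 k (yB j) b) ^+ 2
     + 2 * r * (rot0 (xA i) (yA i) a * rot0 k (yB j) b)
         * (rot1 (xA i) (yA i) a * rot1 k (yB j) b))%:C.
  by rewrite /p ketbra_tens trace_ketbra; exact: xstate_prob.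
(* This is cos s cos t <ZZ> + sin s sin t <XX>, with <ZZ> = p0 + p1 = 1, <XX> = 2r and sines 2 x
   y. *)
have cE i j : correlator p i j =
   ((xA i ^+ 2 - yA i ^+ 2) * (k ^+ 2 - yB j ^+ 2)
    + 8 * r * (xA i * yA i) * (k * yB j))%:C.
{ rewrite /correlator !pE -!(rmorphB, rmorphD) /= /rot0 /rot1 /=.
  congr (_%:C); have -> : p1 = 1 - p0 by rewrite -p01 addrC addKr.
  ring. }
rewrite /chsh !cE -!(rmorphB, rmorphD) /= -[2]/(1 + 1).
rewrite -(rmorph1 (real_complex R)) -rmorphD lecR /xA /yA /yB /=.
rewrite [X in X <= _](_ : _ = 2 * k ^+ 2 * (1 - r ^+ 2)
  + 16 * h ^+ 2 * k ^+ 2 * r ^+ 2); last by ring.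
rewrite h2 => le2.
(* Since 2 = 2 k^2 (1 + r^2), the CHSH value exceeds 2 by 4 k^2 r^2. *)
have kr : 0 < k ^+ 2 * r ^+ 2 by rewrite k2 mulr_gt0 ?invr_gt0 ?exprn_gt0.
by move: k2r le2; lra.
Qed.

(** Entanglement excludes a vanishing coherence between the two support vectors, so the canonical
    form has r > 0. *)
Lemma orthogonal_kernel_violates (rho : 'M[C]_(2 * 2))
    (e f : 'I_2 -> 'cV[C]_2) :
  is_entangled rho -> orthonormal e -> orthonormal f ->
  (forall a, rho *m kron (e a) (f a) = 0) ->
  violates_local_realism rho.
Proof.
move=> [rhos nsep] eo fo rk; have [/psdP[rhoh rhop] tr1] := rhos.
have phio := orthonormal_swap fo; have phif a := swap_complete a fo.
have c0 : dot (kron (e 0) (swap f 0)) (rho *m kron (e 1) (swap f 1)) != 0.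
  apply/eqP => c0; apply: nsep.
  apply: (rank_one_support_separable rhos eo _ phif rk) => // a.
  by rewrite phio eqxx.
have [e' eo'] := xstate_decomposition rhoh eo fo rk c0.
have : 0 < `|dot (kron (e 0) (swap f 0)) (rho *m kron (e 1) (swap f 1))|.
  by rewrite normr_gt0.
move: `|_| => c cpos.
have [r rE] : exists r : R, c = r%:C.
  by exists (complex.Re c); rewrite RRe_real // gtr0_real.
have [p pE] : exists p : 'I_2 -> R, forall a,
    dot (kron (e' a) (swap f a)) (rho *m kron (e' a) (swap f a)) = (p a)%:C.
  exists (fun a => complex.Re
    (dot (kron (e' a) (swap f a)) (rho *m kron (e' a) (swap f a)))) => a.
  by rewrite RRe_real // ger0_real // rhop.
rewrite /= (pE 0) (pE 1) rE tr1 => -[p01 rhoE].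
apply: (xstate_violates eo' phio _ _ rhoE); last by rewrite -ltcR -rE.
by apply: (@complexI R); rewrite rmorphD rmorph1.
Qed.

End Canonical.

(** * Kernel vectors obtained from steering *)

Section Steering.
Variable R : realType.
Local Notation C := R[i].

(** The duality characterising the partial trace; it turns expectations in a conditional state into
    expectations in [rho]. *)
Lemma ptraceA_trace (X : 'M[C]_(2 * 2)) (B : 'M[C]_2) :
  \tr (ptraceA X *m B) = \tr (X *m (1%:M *t B)).
Proof.
rewrite /mxtrace sum_mxtens [RHS]exchange_big; apply: eq_bigr => j _ /=.
rewrite mxE; transitivity
    (\sum_k \sum_i X (mxtens_index (i, j)) (mxtens_index (i, k)) * B k j).
  by apply: eq_bigr => k _; rewrite mxE mulr_suml.
rewrite exchange_big; apply: eq_bigr => i _ /=.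
rewrite mxE sum_mxtens [RHS](bigD1 i) //= [X in _ + X]big1 ?addr0 => [|i' i'i].
  by apply: eq_bigr => k _; rewrite tensmxE mxE eqxx mul1r.
rewrite big1 // => k _; rewrite tensmxE mxE (negbTE i'i).
by rewrite mul0r mulr0.
Qed.

Lemma ptraceB_trace (X : 'M[C]_(2 * 2)) (B : 'M[C]_2) :
  \tr (ptraceB X *m B) = \tr (X *m (B *t 1%:M)).
Proof.
rewrite /mxtrace sum_mxtens; apply: eq_bigr => j _ /=.
rewrite mxE; transitivity
    (\sum_k \sum_i X (mxtens_index (j, i)) (mxtens_index (k, i)) * B k j).
  by apply: eq_bigr => k _; rewrite mxE mulr_suml.
rewrite exchange_big; apply: eq_bigr => i _ /=.
rewrite mxE sum_mxtens; apply: eq_bigr => k _.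
rewrite [RHS](bigD1 i) //= [X in _ + X]big1 ?addr0 => [|i' i'i].
  by rewrite tensmxE mxE eqxx mulr1.
by rewrite tensmxE mxE (negbTE i'i) !mulr0.
Qed.

Lemma proj_measP n (P : 'I_2 -> 'M[C]_2) : is_proj_meas n P ->
  exists2 e, orthonormal e & forall a, P a = e a *m (e a) ^t*.
Proof.
case=> _ [e [eo _ Pe]]; exists e => // a b.
by rewrite /dot eo mxE eqxx mulr1n.
Qed.

(** A rank-one conditional state has vanishing expectation at some unit vector [F 0]. Up to the
    nonzero factor 1/p_a this is the expectation of [rho] at e_a (x) F_0, and [psd_kernel]
    applies. *)
Lemma alice_steering_kernel (rho : 'M[C]_(2 * 2)) :
  psdmx rho -> alice_steers_pure rho ->
  exists e F, [/\ orthonormal e, forall a, orthonormal (F a) &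
    forall a, rho *m kron (e a) (F a 0) = 0].
Proof.
move=> /psdP[rhoh rhop] [n [P [/proj_measP[e eo Pe] pure _]]].
have ker a : exists F, orthonormal F /\ rho *m kron (e a) (F 0) = 0.
  have [p0 [_ _ /singular_kernel[F Fo FF]]] := pure a.
  exists F; split=> //; apply: psd_kernel => //.
  move: FF; rewrite -scalemxAl dotZr => /eqP.
  rewrite mulf_eq0 invr_eq0 => /orP[/eqP//|/eqP].
  rewrite -trace_ketbra mxtrace_mulC ptraceA_trace mxtrace_mulC mulmxA.
  by rewrite tensmx_mul mul1mx mulmx1 Pe ketbra_tens trace_ketbra.
have [F Fk] := boolp.choice ker.
by exists e, F; split=> // a; have [] := Fk a.
Qed.

Lemma bob_steering_kernel (rho : 'M[C]_(2 * 2)) :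
  psdmx rho -> bob_steers_pure rho ->
  exists f h, [/\ orthonormal f, forall b, h b != 0 &
    forall b, rho *m kron (h b) (f b) = 0].
Proof.
move=> /psdP[rhoh rhop] [n [P [/proj_measP[f fo Pf] pure _]]].
have ker b : exists h, h != 0 /\ rho *m kron h (f b) = 0.
  have [p0 [_ _ /singular_kernel[F Fo FF]]] := pure b.
  exists (F 0); split; first by rewrite -dot_eq0 Fo oner_eq0.
  apply: psd_kernel => //.
  move: FF; rewrite -scalemxAl dotZr => /eqP.
  rewrite mulf_eq0 invr_eq0 => /orP[/eqP//|/eqP].
  rewrite -trace_ketbra mxtrace_mulC ptraceB_trace mxtrace_mulC mulmxA.
  by rewrite tensmx_mul mul1mx mulmx1 Pf ketbra_tens trace_ketbra.
have [h hk] := boolp.choice ker.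
by exists f, h; split=> // b; have [] := hk b.
Qed.

End Steering.

Theorem theorem1 (R : realType) (rho : 'M[R[i]]_(2 * 2)) :
  is_entangled rho ->
  alice_steers_pure rho ->
  bob_steers_pure rho ->
  violates_local_realism rho.
Proof.
move=> rhoe; have [rhos nsep] := rhoe; have [rhopsd _] := rhos.
move=> /(alice_steering_kernel rhopsd)[e [F [eo Fo rF]]].
move=> /(bob_steering_kernel rhopsd)[f [h [fo hn0 rf]]].
have [rhoh _] := psdP rhopsd.
have c01 : dot (kron (e 0) (F 0 1)) (rho *m kron (e 1) (F 1 1)) != 0.
  (* [F a 0] is the kernel vector and [F a 1] the conditional state; zero coherence would make [rho]
     separable. *)
  apply/eqP => c01; apply: nsep.
  apply: (@rank_one_support_separable _ rho e (fun a => F a 1) (F^~ 0)) => // a.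
    by rewrite Fo eqxx.
  by have := orthonormal_complete (Fo a); rewrite sum_ord2 addrC.
have [e' [f' [eo' fo' rk]]] :=
  orthogonal_kernel_exists rhoh eo Fo rF c01 fo hn0 rf.
exact: orthogonal_kernel_violates rhoe eo' fo' rk.
Qed.
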